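(* Let $\mathcal{X}$ be a finite set, $U:\mathcal{X}\to\mathbb{R}$ a function, $Q$ the generator of an ergodic continuous-time Markov chain on $\mathcal{X}$ that is reversible with respect to its stationary distribution $\pi$, and $T(t)$ a cooling schedule. Let $M_{1,t}$, $M_{2,t}$ be the associated annealing generators and $\pi_{T(t)}$ the associated Gibbs distribution with normalization constant $Z_{T(t)}$. Then at each fixed $t\geq 0$: (1) (Reversibility) $M_{1,t}$ and $M_{2,t}$ are reversible with respect to $\pi_{T(t)}$. (2) (Peskun ordering) $M_{2,t}\succeq M_{1,t}$, i.e. $M_{2,t}(x,y)\geq M_{1,t}(x,y)$ for all $x\neq y\in\mathcal{X}$. (3) (Quadratic form) For any $f:\mathcal{X}\to\mathbb{R}$ with $f\in\ell^2(\pi_{T(t)})$, $$\langle M_{2,t}f,f\rangle_{\pi_{T(t)}}\leq\langle M_{1,t}f,f\rangle_{\pi_{T(t)}},$$ where $$\langle -M_{2,t}f,f\rangle_{\pi_{T(t)}}=\frac{1}{2Z_{T(t)}}\sum_{x,y\in\mathcal{X}}(f(y)-f(x))^2e^{-\frac{\min\{U(x),U(y)\}}{T(t)}}Q(x,y)\pi(x),$$ $$\langle -M_{1,t}f,f\rangle_{\pi_{T(t)}}=\frac{1}{2Z_{T(t)}}\sum_{x,y\in\mathcal{X}}(f(y)-f(x))^2e^{-\frac{\max\{U(x),U(y)\}}{T(t)}}Q(x,y)\pi(x).$$ (4) (Spectral gap) $\lambda_2(-M_{2,t})\geq\lambda_2(-M_{1,t})$.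
   Context: A cooling schedule is a function $T(t)>0$, $t\ge 0$, monotonically decreasing to $0$ as $t\to\infty$. Reversibility of a generator $G$ with respect to a probability measure $\mu$ means $\mu(x)G(x,y)=\mu(y)G(y,x)$ for all $x,y$. The Gibbs distribution is $\pi_{T(t)}(x)=e^{-U(x)/T(t)}\pi(x)/Z_{T(t)}$ with $Z_{T(t)}=\sum_{x\in\mathcal{X}}e^{-U(x)/T(t)}\pi(x)$. With $a_+=\max\{a,0\}$, the generators are defined for $x\neq y$ by $$M_{1,t}(x,y)=Q(x,y)\min\{1,e^{(U(x)-U(y))/T(t)}\}=Q(x,y)e^{-(U(y)-U(x))_+/T(t)},$$ $$M_{2,t}(x,y)=Q(x,y)\max\{1,e^{(U(x)-U(y))/T(t)}\}=Q(x,y)e^{(U(x)-U(y))_+/T(t)},$$ and $M_{i,t}(x,x)=-\sum_{z\neq x}M_{i,t}(x,z)$ for $i=1,2$. The inner product is $\langle f,g\rangle_\mu=\sum_x f(x)g(x)\mu(x)$. For a generator $G$ reversible with respect to $\mu$, $\lambda_2(-G)$ is its spectral gap (second smallest eigenvalue of $-G$), equivalently $\lambda_2(-G)=\inf\{\langle -Gf,f\rangle_\mu/\langle f,f\rangle_\mu:\ f\neq 0,\ \mu(f)=0\}$, where $\mu(f)=\sum_x f(x)\mu(x)$. *)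

(* Defs.v *)
From mathcomp Require Import all_boot all_order all_algebra.
From mathcomp Require Import boolp classical_sets functions reals ereal.
From mathcomp Require Import topology normedtype sequences exp.

Set Implicit Arguments.
Unset Strict Implicit.
Unset Printing Implicit Defensive.

Import Order.TTheory GRing.Theory Num.Theory.
Import numFieldNormedType.Exports.

Local Open Scope classical_set_scope.
Local Open Scope ring_scope.

Definition is_distribution (R : realType) (X : finType) (mu : X -> R) : Prop :=
  (forall x, 0 <= mu x) /\ \sum_x mu x = 1.

Definition is_generator (R : realType) (X : finType) (G : X -> X -> R) : Prop :=
  (forall x y, x != y -> 0 <= G x y) /\ (forall x, \sum_y G x y = 0).

(* For a continuous-time chain on a finite set (no periodicity), ergodicity is
   irreducibility: every state leads to every other one through transitions of
   positive rate. *)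
Definition ergodic (R : realType) (X : finType) (G : X -> X -> R) : Prop :=
  forall x y, connect [rel a b | 0 < G a b] x y.

Definition stationary (R : realType) (X : finType)
    (G : X -> X -> R) (mu : X -> R) : Prop :=
  forall y, \sum_x mu x * G x y = 0.

Definition reversible (R : realType) (X : finType)
    (G : X -> X -> R) (mu : X -> R) : Prop :=
  forall x y, mu x * G x y = mu y * G y x.

Definition cooling_schedule (R : realType) (T : R -> R) : Prop :=
  [/\ forall t, 0 <= t -> 0 < T t,
      forall s t, 0 <= s -> s <= t -> T t <= T s
    & T t @[t --> +oo] --> (0 : R)].

Definition partition_function (R : realType) (X : finType)
    (U pi : X -> R) (T : R -> R) (t : R) : R :=
  \sum_x expR (- U x / T t) * pi x.

Definition gibbs (R : realType) (X : finType)
    (U pi : X -> R) (T : R -> R) (t : R) (x : X) : R :=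
  expR (- U x / T t) * pi x / partition_function U pi T t.

(* The off-diagonal rates are those of K; the diagonal entries of K are
   ignored. *)
Definition generator_of_rates (R : realType) (X : finType)
    (K : X -> X -> R) (x y : X) : R :=
  if x == y then - \sum_(z | z != x) K x z else K x y.

Definition M1 (R : realType) (X : finType) (U : X -> R) (Q : X -> X -> R)
    (T : R -> R) (t : R) : X -> X -> R :=
  generator_of_rates
    (fun x y => Q x y * Num.min 1 (expR ((U x - U y) / T t))).

Definition M2 (R : realType) (X : finType) (U : X -> R) (Q : X -> X -> R)
    (T : R -> R) (t : R) : X -> X -> R :=
  generator_of_rates
    (fun x y => Q x y * Num.max 1 (expR ((U x - U y) / T t))).

Definition peskun_ge (R : realType) (X : finType) (G H : X -> X -> R) : Prop :=
  forall x y, x != y -> H x y <= G x y.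

Definition apply_gen (R : realType) (X : finType) (G : X -> X -> R)
    (f : X -> R) (x : X) : R :=
  \sum_y G x y * f y.

Definition inner (R : realType) (X : finType) (mu f g : X -> R) : R :=
  \sum_x f x * g x * mu x.

Definition matrix_of (R : realType) (X : finType) (G : X -> X -> R) :
    'M[R]_#|X| :=
  \matrix_(i, j) G (enum_val i) (enum_val j).

(* s lists all eigenvalues in nondecreasing order, with multiplicity. *)
Definition sorted_spectrum (R : realType) (n : nat) (A : 'M[R]_n)
    (s : seq R) : Prop :=
  sorted <=%R s /\ char_poly A = \prod_(a <- s) ('X - a%:P).

(* A sorted spectrum is unique when it exists, and it does exist when A is
   self-adjoint for some inner product; the infimum below is then that of a
   singleton, and it is +oo (the infimum of the empty set) on a one-point
   space, where there is no second eigenvalue. *)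
Definition lambda2 (R : realType) (X : finType) (G : X -> X -> R) : \bar R :=
  ereal_inf [set (s`_1)%:E | s in
    [set s : seq R | sorted_spectrum (matrix_of G) s /\ (1 < size s)%N]].

(* Main.v *)
Require Import Defs.
From mathcomp Require Import all_boot all_order all_algebra.
From mathcomp Require Import boolp classical_sets functions reals ereal.
From mathcomp Require Import topology normedtype sequences exp.
From mathcomp Require Import sesquilinear spectral complex ring.

(** At a fixed time, put T = T(t). The identity

      e^(-a/T) min(1, e^((a-b)/T)) = e^(-max(a,b)/T)

    and its companion with min and max exchanged show that the Gibbs flux
    from x to y is Q(x,y) pi(x) / Z multiplied by a factor symmetric in x and
    y. Since Q is reversible for pi, both annealing generators are reversible
    for the Gibbs distribution, and their rates are ordered because min(1,c)
    <= max(1,c). The quadratic form of a reversible generator is the Dirichlet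
    form ([dirichlet_form]), a sum of squares weighted by the off-diagonal
    fluxes; substituting the fluxes gives the two formulas, and larger rates
    give a larger form ([peskun_dirichlet_le]).

    The comparison of spectral gaps follows from an inequality between
    quadratic forms. Irreducibility and reversibility force pi > 0, so the
    Gibbs distribution mu is positive too, and conjugation by diag(sqrt mu)
    turns -M1 and -M2 into real symmetric matrices, with the same
    characteristic polynomials, whose forms are the Dirichlet forms. It remains
    to see that A <= B as quadratic forms implies that the k-th smallest
    eigenvalue of A is at most that of B ([sorted_spectrum_le]). This is the
    dimension count behind the Courant-Fischer principle: if B had more
    eigenvalues <= c than A does, the span of the corresponding eigenvectors
    of B would meet the span of the eigenvectors of A with eigenvalue > c in a
    nonzero vector v, for which <Bv,v> <= c|v|^2 < <Av,v>.

    The eigenbases are taken over the complex numbers, where Hermitian matrices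
    are unitarily diagonalizable. The order of the real forms still applies: at
    a complex vector, the form of a real symmetric matrix is the sum of its
    values at the real and the imaginary part ([quadratic_form_Re]). *)

Set Implicit Arguments.
Unset Strict Implicit.
Unset Printing Implicit Defensive.

Import Order.TTheory GRing.Theory Num.Theory.
Import numFieldNormedType.Exports.

Local Open Scope ring_scope.
Local Open Scope sesquilinear_scope.

(** * Spectrum of a real symmetric matrix *)

(** Similarity, without inverting P: taking determinants in
    P (X - A) = (X - B) P leaves the factor det P to be cancelled. *)
Lemma char_poly_intertwine (F : fieldType) n (P A B : 'M[F]_n) :
  P \in unitmx -> P *m A = B *m P -> char_poly A = char_poly B.
Proof.
rewrite unitmxE unitfE => detP0 PAB.
have eqPC : map_mx polyC P *m char_poly_mx A = char_poly_mx B *m map_mx polyC P.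
  rewrite /char_poly_mx mulmxBr mulmxBl -!map_mxM PAB.
  by rewrite scalar_mxC.
have := congr1 determinant eqPC.
rewrite !det_mulmx det_map_mx mulrC => /mulIf; apply.
by rewrite polyC_eq0.
Qed.

(** Transfers an inequality between real quadratic forms to complex vectors.
    Taking the real part discards the cross terms between the two parts of v. *)
Lemma quadratic_form_Re (R : rcfType) n (A : 'M[R]_n) (v : 'rV[R[i]]_n) :
  let re := map_mx (@complex.Re R) v in let im := map_mx (@complex.Im R) v in
  complex.Re ((v *m map_mx (real_complex R) A *m v ^t*) 0 0) =
    (re *m A *m re^T) 0 0 + (im *m A *m im^T) 0 0.
Proof.
move=> re im; rewrite !mxE raddf_sum -big_split; apply: eq_bigr => j _ /=.
rewrite !mxE !mulr_suml raddf_sum -big_split; apply: eq_bigr => i _ /=.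
rewrite !mxE; case: (v 0 i) => a b; case: (v 0 j) => c d /=.
ring.
Qed.

(** The eigenvector matrix P is complex, but the eigenvalues of a Hermitian
    matrix are real, so that the characteristic polynomial already splits over
    R. *)
Lemma symmetric_diagonalization (R : rcfType) n (A : 'M[R]_n) : A^T = A ->
  exists (P : 'M[R[i]]_n) (d : 'rV[R]_n),
    [/\ P \is unitarymx,
        map_mx (real_complex R) A =
          P ^t* *m diag_mx (map_mx (real_complex R) d) *m P
      & char_poly A = \prod_(i < n) ('X - (d 0 i)%:P)].
Proof.
move=> symA; set Ac := map_mx _ A.
have Aherm : Ac \is hermsymmx.
  apply/is_hermitianmxP; rewrite expr0 scale1r.
  apply/matrixP=> i j; rewrite !mxE -[in LHS]symA mxE.
  exact/esym/conjc_real.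
have /orthomx_spectralP Aspec := hermitian_normalmx Aherm.
have /mxOverP dreal := hermitian_spectral_diag_real Aherm.
pose d : 'rV[R]_n := map_mx (@complex.Re R) (spectral_diag Ac).
have dE : spectral_diag Ac = map_mx (real_complex R) d.
  by apply/rowP=> i; rewrite !mxE RRe_real.
have Punit := spectral_unitarymx Ac.
rewrite dE in Aspec.
exists (spectralmx Ac), d; split => //.
  by rewrite -invmx_unitary.
apply: (map_poly_inj (real_complex R)); rewrite map_char_poly -/Ac.
rewrite rmorph_prod /=.
under eq_bigr do rewrite rmorphB /= map_polyX map_polyC /=.
rewrite (@char_poly_intertwine _ _ (spectralmx Ac) Ac
           (diag_mx (map_mx (real_complex R) d))) ?spectral_unit //.
  rewrite char_poly_trig ?diag_mx_is_trig //.
  by apply: eq_bigr => i _; rewrite !mxE eqxx mulr1n.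
by rewrite {2}Aspec !mulmxA mulmxV ?spectral_unit // mul1mx.
Qed.

(** Unique factorization makes any two lists of eigenvalues agree up to order,
    which lets eigenvalues be counted on an eigenbasis. *)
Lemma perm_spectrum (R : fieldType) n (M : 'M[R]_n) (d : 'rV[R]_n) (s : seq R) :
  char_poly M = \prod_(i < n) ('X - (d 0 i)%:P) ->
  char_poly M = \prod_(a <- s) ('X - a%:P) ->
  perm_eq s [seq d 0 i | i <- enum 'I_n].
Proof.
move=> dE sE; apply: prod_XsubC_eq; rewrite -sE dE big_map.
by rewrite big_enum.
Qed.

Lemma sorted_spectrum_exists (R : realType) n (A : 'M[R]_n) :
  A^T = A -> exists s, sorted_spectrum A s.
Proof.
move=> symA; have [P [a [Punit AE aE]]] := symmetric_diagonalization symA.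
exists (sort <=%R [seq a 0 i | i <- enum 'I_n]); split.
  exact: sort_le_sorted.
rewrite aE (perm_big _ (permEl (perm_sort _ _))) /= big_map.
by rewrite big_enum.
Qed.

Lemma size_spectrum (R : realType) n (A : 'M[R]_n) (s : seq R) :
  sorted_spectrum A s -> size s = n.
Proof.
move=> [_ sE]; apply/eqP; rewrite -eqSS -(size_prod_XsubC s id).
by rewrite -sE size_char_poly.
Qed.

Lemma Re_mul_conj (R : rcfType) (z : R[i]) :
  complex.Re (z * Num.conj z) = complex.Re z ^+ 2 + complex.Im z ^+ 2.
Proof. by case: z => a b /=; ring. Qed.

Lemma mul_conj_Re_ge0 (R : rcfType) (z : R[i]) :
  0 <= complex.Re (z * Num.conj z).
Proof. by rewrite Re_mul_conj addr_ge0 ?sqr_ge0. Qed.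

(** The entries of v P^* are the coordinates of v in the orthonormal basis
    formed by the rows of P. *)
Lemma quadratic_form_diag (R : rcfType) n (P : 'M[R[i]]_n) (d : 'rV[R]_n)
    (v : 'rV[R[i]]_n) :
  complex.Re ((v *m (P ^t* *m diag_mx (map_mx (real_complex R) d) *m P)
                *m v ^t*) 0 0) =
  \sum_i d 0 i * complex.Re ((v *m P ^t*) 0 i * Num.conj ((v *m P ^t*) 0 i)).
Proof.
rewrite !mulmxA -(mulmxA _ P).
have -> : P *m v ^t* = (v *m P ^t*) ^t*.
  by rewrite trmx_mul map_mxM /= trmxCK.
move: (v *m _) => w; rewrite mxE raddf_sum; apply: eq_bigr => i _ /=.
rewrite mul_mx_diag !mxE; case: (w 0 i) => a b /=; ring.
Qed.

Lemma unitary_normsq (R : rcfType) n (P : 'M[R[i]]_n) (v : 'rV[R[i]]_n) :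
  P \is unitarymx ->
  \sum_i complex.Re ((v *m P ^t*) 0 i * Num.conj ((v *m P ^t*) 0 i)) =
  complex.Re ((v *m v ^t*) 0 0).
Proof.
move=> Punit; have PP : P ^t* *m P = 1%:M.
  by rewrite -invmx_unitary // mulVmx // unitarymx_unit.
have -> : v *m v ^t* = (v *m P ^t*) *m (v *m P ^t*) ^t*.
  by rewrite trmx_mul map_mxM /= trmxCK mulmxA -(mulmxA v) PP mulmx1.
rewrite mxE raddf_sum; apply: eq_bigr => i _; congr (complex.Re (_ * _)).
by rewrite !mxE.
Qed.

(** * Monotonicity of the sorted spectrum *)

(** Fewer than n homogeneous linear equations in n unknowns have a nonzero
    common solution. With P and Q holding orthonormal eigenbases, this is how
    two spans of eigenvectors of large total dimension are seen to meet. *)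
Lemma common_kernel (F : fieldType) n (P Q : 'M[F]_n) (a b : pred 'I_n) :
  (#|a| + #|b| < n)%N ->
  exists v : 'rV[F]_n, [/\ v != 0, forall i, a i -> (v *m P) 0 i = 0
                                 & forall i, b i -> (v *m Q) 0 i = 0].
Proof.
move=> lt_n.
pose K := row_mx (colsub (fun i : 'I_#|a| => enum_val i) P)
                 (colsub (fun i : 'I_#|b| => enum_val i) Q).
have kerK : nz_row (kermx K) *m K = 0.
  by apply/sub_kermxP; exact: nz_row_sub.
exists (nz_row (kermx K)); split.
- rewrite nz_row_eq0 -mxrank_eq0 mxrank_ker -lt0n subn_gt0.
  exact: leq_ltn_trans (rank_leq_col K) lt_n.
- move=> i ai; move: kerK; rewrite mul_mx_row -row_mx0 => /eq_row_mx [].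
  rewrite mulmx_colsub => /rowP/(_ (enum_rank_in (ai : i \in a) i)) + _.
  by rewrite mxE [RHS]mxE enum_rankK_in.
- move=> i bi; move: kerK; rewrite mul_mx_row -row_mx0 => /eq_row_mx [] _.
  rewrite mulmx_colsub => /rowP/(_ (enum_rank_in (bi : i \in b) i)).
  by rewrite mxE [RHS]mxE enum_rankK_in.
Qed.

Lemma count_enum_le (R : numDomainType) n (d : 'rV[R]_n) (c : R) :
  count (<= c) [seq d 0 i | i <- enum 'I_n] = #|[pred i | (d 0 i <= c)%R]|.
Proof.
rewrite count_map -sum1_count -sum1_card big_enum_cond /=.
by apply: eq_bigl => i; rewrite inE.
Qed.

Section Monotonicity.
Variables (R : realType) (n : nat) (A B : 'M[R]_n).
Hypotheses (symA : A^T = A) (symB : B^T = B).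
Hypothesis form_le : forall v : 'rV[R]_n,
  (v *m A *m v^T) 0 0 <= (v *m B *m v^T) 0 0.

(** If the inequality failed, common_kernel would give a nonzero v with no
    component on the eigenvectors of A for eigenvalues <= c, nor on those of B
    for eigenvalues > c; then <Bv,v> <= c|v|^2 < <Av,v>. *)
Lemma card_eigenvalues_le (P Q : 'M[R[i]]_n) (a b : 'rV[R]_n) (c : R) :
  P \is unitarymx -> Q \is unitarymx ->
  map_mx (real_complex R) A =
    P ^t* *m diag_mx (map_mx (real_complex R) a) *m P ->
  map_mx (real_complex R) B =
    Q ^t* *m diag_mx (map_mx (real_complex R) b) *m Q ->
  (#|[pred i | (b 0 i <= c)%R]| <= #|[pred i | (a 0 i <= c)%R]|)%N.
Proof.
move=> Punit Qunit AE BE; rewrite leqNgt; apply/negP => lt_ab.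
have [|v [v0 Pv Qv]] := @common_kernel _ n (P ^t*) (Q ^t*)
    [pred i | a 0 i <= c] (predC [pred i | b 0 i <= c]).
  by rewrite -[X in (_ < X)%N]card_ord -(cardC [pred i | b 0 i <= c]) ltn_add2r.
have formB : complex.Re ((v *m map_mx (real_complex R) B *m v ^t*) 0 0) <=
    c * complex.Re ((v *m v ^t*) 0 0).
  rewrite BE quadratic_form_diag -(unitary_normsq v Qunit) mulr_sumr.
  apply: ler_sum => i _; case: (leP (b 0 i) c) => [bc|cb].
    by rewrite ler_wpM2r ?mul_conj_Re_ge0.
  by rewrite Qv ?mul0r /= ?raddf0 ?mulr0 // -ltNge.
have formA : c * complex.Re ((v *m v ^t*) 0 0) <
    complex.Re ((v *m map_mx (real_complex R) A *m v ^t*) 0 0).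
  rewrite AE quadratic_form_diag -(unitary_normsq v Punit) mulr_sumr.
  (* A nonzero coordinate of v makes the inequality strict. *)
  have /rV0Pn [k wk] : v *m P ^t* != 0.
    apply: contraNneq v0 => w0.
    rewrite -(mulmx1 v); have <- := unitarymxP (etrans (trmxC_unitary P) Punit).
    by rewrite trmxCK mulmxA w0 mul0mx.
  rewrite [ltLHS](bigD1 k) // [ltRHS](bigD1 k) //=; apply: ltr_leD.
    have ck : c < a 0 k.
      by rewrite ltNge; apply: contra wk => /Pv ->.
    rewrite ltr_pM2r // Re_mul_conj lt0r addr_ge0 ?sqr_ge0 // andbT.
    rewrite paddr_eq0 ?sqr_ge0 // !sqrf_eq0.
    by apply: contra wk => re_im0; rewrite eq_complex.
  apply: ler_sum => i _; case: (leP (a 0 i) c) => [ac|/ltW ca].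
    by rewrite Pv ?mul0r /= ?raddf0 ?mulr0.
  by rewrite ler_wpM2r ?mul_conj_Re_ge0.
suff /(lt_le_trans formA)/lt_le_trans/(_ formB) :
    complex.Re ((v *m map_mx (real_complex R) A *m v ^t*) 0 0) <=
    complex.Re ((v *m map_mx (real_complex R) B *m v ^t*) 0 0).
  by rewrite ltxx.
by rewrite !quadratic_form_Re lerD.
Qed.

(** The k-th entry of a nondecreasing list is at most c as soon as more than k
    entries are; c is taken to be the k-th eigenvalue of B. *)
Theorem sorted_spectrum_le (s r : seq R) (k : nat) :
  sorted_spectrum A s -> sorted_spectrum B r -> (k < n)%N -> s`_k <= r`_k.
Proof.
move=> [s_sorted sE] [r_sorted rE] ltkn.
have [P [a [Punit AE aE]]] := symmetric_diagonalization symA.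
have [Q [b [Qunit BE bE]]] := symmetric_diagonalization symB.
have /permP s_a := perm_spectrum aE sE.
have /permP r_b := perm_spectrum bE rE.
(* Indices start at 0, so k.+1 eigenvalues of A have to be <= r`_k. *)
apply: nth_count_le => //.
rewrite s_a count_enum_le.
apply: leq_trans (card_eigenvalues_le r`_k Punit Qunit AE BE).
rewrite -count_enum_le -r_b.
have size_r : size r = n.
  by have := r_b predT; rewrite !count_predT size_map size_enum_ord.
rewrite ltnNge; apply/negP => le_ck.
have := @nth_count_gt _ _ r`_k 0 r k r_sorted.
by rewrite le_ck size_r ltkn ltxx => /(_ isT).
Qed.

End Monotonicity.

(** * Reversible generators and their Dirichlet forms *)

Section Reversible.
Variables (R : realType) (X : finType).
Implicit Types (G H : X -> X -> R) (mu : X -> R).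

Lemma sum_generator_of_rates (K : X -> X -> R) x :
  \sum_y generator_of_rates K x y = 0.
Proof.
rewrite (bigD1 x) //= {1}/generator_of_rates eqxx addrC.
apply/eqP; rewrite subr_eq0; apply/eqP; apply: eq_bigr => y yx.
by rewrite /generator_of_rates eq_sym (negPf yx).
Qed.

Lemma reversible_generator_of_rates (K : X -> X -> R) mu :
  reversible K mu -> reversible (generator_of_rates K) mu.
Proof.
move=> rev x y; rewrite /generator_of_rates [y == x]eq_sym.
by case: eqVneq => [->|].
Qed.

Lemma inner_opp_gen G mu f :
  inner mu (apply_gen (- G) f) f = - inner mu (apply_gen G f) f.
Proof.
rewrite -sumrN; apply: eq_bigr => x _; rewrite -!mulNr; congr (_ * _ * _).
by rewrite -sumrN; apply: eq_bigr => y _; rewrite -mulNr.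
Qed.

(** Expanding the square, the terms in f(x)^2 vanish because rows of G sum to
    0, and those in f(y)^2 reduce to them by reversibility; only the cross terms
    survive. *)
Lemma dirichlet_form G mu f :
  (forall x, \sum_y G x y = 0) -> reversible G mu ->
  inner mu (apply_gen (- G) f) f =
  2^-1 * \sum_x \sum_y (f y - f x) ^+ 2 * (mu x * G x y).
Proof.
move=> row0 rev.
have sq_x : \sum_x \sum_y f x ^+ 2 * (mu x * G x y) = 0.
  apply: big1 => x _; rewrite -mulr_sumr -mulr_sumr row0; ring.
have sq_y : \sum_x \sum_y f y ^+ 2 * (mu x * G x y) = 0.
  rewrite exchange_big /= -[RHS]sq_x; apply: eq_bigr => x _.
  by apply: eq_bigr => y _; rewrite rev.
have innerE : inner mu (apply_gen G f) f =
    \sum_x \sum_y f x * f y * (mu x * G x y).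
  apply: eq_bigr => x _; rewrite !mulr_suml; apply: eq_bigr => y _; ring.
have -> : \sum_x \sum_y (f y - f x) ^+ 2 * (mu x * G x y) =
    \sum_x \sum_y f x ^+ 2 * (mu x * G x y)
    + \sum_x \sum_y f y ^+ 2 * (mu x * G x y)
    - 2 * \sum_x \sum_y f x * f y * (mu x * G x y).
  rewrite mulr_sumr -sumrN -!big_split; apply: eq_bigr => x _ /=.
  rewrite mulr_sumr -sumrN -!big_split; apply: eq_bigr => y _ /=; ring.
by rewrite sq_x sq_y inner_opp_gen innerE; field.
Qed.

(** Diagonal entries of the generators, which are ordered the other way, are
    multiplied by (f x - f x)^2 = 0 in the Dirichlet form. *)
Lemma peskun_dirichlet_le G H mu f : (forall x, 0 <= mu x) ->
  (forall x, \sum_y G x y = 0) -> (forall x, \sum_y H x y = 0) ->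
  reversible G mu -> reversible H mu -> peskun_ge G H ->
  inner mu (apply_gen (- H) f) f <= inner mu (apply_gen (- G) f) f.
Proof.
move=> mu_ge0 G0 H0 revG revH GH; rewrite !dirichlet_form //.
apply: ler_wpM2l; first by rewrite invr_ge0.
apply: ler_sum => x _; apply: ler_sum => y _.
have [->|xy] := eqVneq x y; first by rewrite subrr expr0n /= !mul0r.
by rewrite !ler_wpM2l ?sqr_ge0 ?GH.
Qed.

(** Positivity of pi propagates along every transition: if pi x > 0 and
    Q x y > 0, the flux from y to x equals the positive flux from x to y. *)
Lemma ergodic_reversible_gt0 (Q : X -> X -> R) (pi : X -> R) :
  ergodic Q -> is_distribution pi -> reversible Q pi -> forall x, 0 < pi x.
Proof.
move=> erg [pi_ge0 pi1] rev.
have [x0 x0_gt0] : exists x, 0 < pi x.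
  apply/existsP; apply: contraT; rewrite negb_exists => /forallP pi_le0.
  move: pi1; rewrite big1 => [/esym/eqP|x _]; first by rewrite oner_eq0.
  by apply/eqP; rewrite eq_le pi_ge0 andbT leNgt.
move=> y; have /connectP [p + ->] := erg x0 y.
elim: p x0 x0_gt0 => [//|z p IHp] x x_gt0 /= /andP[Qxz].
apply: IHp; rewrite lt_neqAle pi_ge0 andbT eq_sym.
apply: contraTneq (mulr_gt0 x_gt0 Qxz) => z0.
by rewrite rev z0 mul0r ltxx.
Qed.

(** * Comparison of spectral gaps *)

(** The conjugate of G by diag(sqrt mu). The map f |-> f sqrt(mu) is an isometry
    from l^2(mu) to the Euclidean space, so G, self-adjoint for mu, becomes a
    symmetric matrix. *)
Definition symmetrization G mu : 'M[R]_#|X| :=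
  \matrix_(i, j) (Num.sqrt (mu (enum_val i)) * G (enum_val i) (enum_val j)
                    / Num.sqrt (mu (enum_val j))).

Lemma symmetrization_sym G mu : (forall x, 0 < mu x) -> reversible G mu ->
  (symmetrization G mu)^T = symmetrization G mu.
Proof.
move=> mu_gt0 rev; apply/matrixP=> i j; rewrite !mxE.
move: (enum_val i) (enum_val j) => x y.
have sx : Num.sqrt (mu x) != 0 by rewrite gt_eqF // sqrtr_gt0.
have sy : Num.sqrt (mu y) != 0 by rewrite gt_eqF // sqrtr_gt0.
apply: (mulfI sx); apply: (mulfI sy).
transitivity (Num.sqrt (mu y) ^+ 2 * G y x); first by field.
transitivity (Num.sqrt (mu x) ^+ 2 * G x y); last by field.
by rewrite !sqr_sqrtr ?ltW.
Qed.

Lemma char_poly_symmetrization G mu : (forall x, 0 < mu x) ->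
  char_poly (matrix_of G) = char_poly (symmetrization G mu).
Proof.
move=> mu_gt0.
have s_neq0 x : Num.sqrt (mu x) != 0 by rewrite gt_eqF // sqrtr_gt0.
apply: (@char_poly_intertwine _ _
  (diag_mx (\row_i Num.sqrt (mu (enum_val i))))).
  rewrite unitmxE det_diag unitfE; apply/prodf_neq0 => i _.
  by rewrite mxE.
apply/matrixP=> i j; rewrite mul_diag_mx mul_mx_diag !mxE.
by rewrite divfK.
Qed.

Lemma symmetrization_form G mu (v : 'rV[R]_#|X|) : (forall x, 0 < mu x) ->
  let f x := v 0 (enum_rank x) / Num.sqrt (mu x) in
  (v *m symmetrization G mu *m v^T) 0 0 = inner mu f (apply_gen G f).
Proof.
move=> mu_gt0 f.
have s_neq0 x : Num.sqrt (mu x) != 0 by rewrite gt_eqF // sqrtr_gt0.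
have sum_enum (F : X -> R) : \sum_x F x = \sum_(i < #|X|) F (enum_val i).
  by rewrite -(big_enum_val F).
rewrite -mulmxA mxE /inner sum_enum; apply: eq_bigr => i _.
rewrite /apply_gen mxE sum_enum.
rewrite !mulr_sumr mulr_suml; apply: eq_bigr => j _.
rewrite !mxE /f !enum_valK.
rewrite -[X in _ = _ * X](sqr_sqrtr (ltW (mu_gt0 (enum_val i)))).
have := s_neq0 (enum_val i); have := s_neq0 (enum_val j).
move: (Num.sqrt _) (Num.sqrt _) => a b b0 a0; field.
by rewrite a0 b0.
Qed.

(** Both gaps are infima over the sorted spectra, so each spectrum of H must be
    matched by one of G whose second entry is no larger. That G has a real
    spectrum at all comes from its symmetrization; on a one-point space both
    infima are empty. *)
Theorem lambda2_le G H mu : (forall x, 0 < mu x) ->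
  reversible G mu -> reversible H mu ->
  (forall f, inner mu (apply_gen G f) f <= inner mu (apply_gen H f) f) ->
  (lambda2 G <= lambda2 H)%E.
Proof.
move=> mu_gt0 revG revH form_le.
have symG := symmetrization_sym mu_gt0 revG.
have symH := symmetrization_sym mu_gt0 revH.
have innerC (f g : X -> R) : inner mu f g = inner mu g f.
  by apply: eq_bigr => x _; rewrite [f x * _]mulrC.
apply/ereal_infP => _ [r [specH size_r] <-].
have [s specG] := sorted_spectrum_exists symG.
rewrite /sorted_spectrum (char_poly_symmetrization H mu_gt0) in specH.
have size_rE := size_spectrum specH; have size_sE := size_spectrum specG.
apply: ge_ereal_inf; exists (s`_1)%:E.
  exists s => //; split; last by rewrite size_sE -size_rE.
  by rewrite /sorted_spectrum (char_poly_symmetrization G mu_gt0).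
rewrite lee_fin; apply: (sorted_spectrum_le symG symH _ specG specH).
  by move=> v; rewrite !symmetrization_form // innerC [leRHS]innerC.
by rewrite -size_rE.
Qed.

End Reversible.

(** * Annealing generators at a fixed temperature *)

Section Annealing.
Variables (R : realType) (X : finType) (U : X -> R) (Q : X -> X -> R).
Variables (pi : X -> R) (T : R -> R) (t : R).
Hypotheses (Q_reversible : reversible Q pi) (T_gt0 : 0 < T t).

Local Notation Z := (partition_function U pi T t).

(** Detailed balance in the Metropolis rule: the right-hand side is symmetric in
    a and b. *)
Lemma gibbs_min_rate (a b : R) :
  expR (- a / T t) * Num.min 1 (expR ((a - b) / T t)) =
  expR (- (Num.max a b / T t)).
Proof.
rewrite -expR0; case: (leP a b) => ab.
  rewrite min_r; first by rewrite -expRD; congr expR; ring.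
  by rewrite ler_expR pmulr_lle0 ?invr_gt0 // subr_le0.
rewrite min_l; first by rewrite -expRD; congr expR; ring.
by rewrite ler_expR pmulr_lge0 ?invr_gt0 // subr_ge0 ltW.
Qed.

Lemma gibbs_max_rate (a b : R) :
  expR (- a / T t) * Num.max 1 (expR ((a - b) / T t)) =
  expR (- (Num.min a b / T t)).
Proof.
rewrite -expR0; case: (leP a b) => ab.
  rewrite max_l; first by rewrite -expRD; congr expR; ring.
  by rewrite ler_expR pmulr_lle0 ?invr_gt0 // subr_le0.
rewrite max_r; first by rewrite -expRD; congr expR; ring.
by rewrite ler_expR pmulr_lge0 ?invr_gt0 // subr_ge0 ltW.
Qed.

(** The two generators differ only in the acceptance function, rate = min 1 or
    max 1, and in the energy level it produces, max or min respectively; their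
    reversibility and Dirichlet forms are derived at once from the relation
    between the two. *)
Section Rates.
Variables rate level : R -> R -> R.
Hypothesis levelC : commutative level.
Hypothesis gibbs_rate : forall a b : R,
  expR (- a / T t) * rate a b = expR (- (level a b / T t)).

Let M := generator_of_rates (fun x y => Q x y * rate (U x) (U y)).

Lemma gibbs_flux x y :
  gibbs U pi T t x * (Q x y * rate (U x) (U y)) =
  Z^-1 * (expR (- (level (U x) (U y) / T t)) * Q x y * pi x).
Proof. by rewrite -gibbs_rate /gibbs; ring. Qed.

Lemma gibbs_reversible : reversible M (gibbs U pi T t).
Proof.
apply: reversible_generator_of_rates => x y.
rewrite !gibbs_flux levelC -!mulrA [Q x y * _]mulrC [Q y x * _]mulrC.
by rewrite Q_reversible.
Qed.

Lemma gibbs_dirichlet_form f :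
  inner (gibbs U pi T t) (apply_gen (- M) f) f =
  1 / (2 * Z) * \sum_x \sum_y
    (f y - f x) ^+ 2 * expR (- (level (U x) (U y) / T t)) * Q x y * pi x.
Proof.
rewrite dirichlet_form;
  [|exact: sum_generator_of_rates|exact: gibbs_reversible].
rewrite div1r invfM -mulrA; congr (_ * _).
rewrite mulr_sumr; apply: eq_bigr => x _.
rewrite mulr_sumr; apply: eq_bigr => y _.
have [->|xy] := eqVneq x y; first by rewrite subrr expr0n /= !mul0r mulr0.
by rewrite /M /generator_of_rates (negPf xy) gibbs_flux; ring.
Qed.

End Rates.
End Annealing.

Theorem lemma2p1 (R : realType) (X : finType) (U : X -> R)
    (Q : X -> X -> R) (pi : X -> R) (T : R -> R)
    (Q_generator : is_generator Q)
    (Q_ergodic : ergodic Q)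
    (pi_distribution : is_distribution pi)
    (pi_stationary : stationary Q pi)
    (Q_reversible : reversible Q pi)
    (T_cooling : cooling_schedule T)
    (t : R) (t_ge0 : 0 <= t) :
  let M1t := M1 U Q T t in
  let M2t := M2 U Q T t in
  let piT := gibbs U pi T t in
  let Z := partition_function U pi T t in
  [/\ reversible M1t piT /\ reversible M2t piT,
      peskun_ge M2t M1t,
      forall f : X -> R,
        [/\ inner piT (apply_gen M2t f) f <= inner piT (apply_gen M1t f) f,
            inner piT (apply_gen (- M2t) f) f =
              1 / (2 * Z) * \sum_x \sum_y
                (f y - f x) ^+ 2 * expR (- (Num.min (U x) (U y) / T t))
                  * Q x y * pi x
          & inner piT (apply_gen (- M1t) f) f =
              1 / (2 * Z) * \sum_x \sum_y
                (f y - f x) ^+ 2 * expR (- (Num.max (U x) (U y) / T t))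
                  * Q x y * pi x]
    & (lambda2 (- M1t)%R <= lambda2 (- M2t)%R)%E].
Proof.
move=> M1t M2t piT Z.
have Tt_gt0 : 0 < T t by case: T_cooling => /(_ t t_ge0).
have pi_gt0 := ergodic_reversible_gt0 Q_ergodic pi_distribution Q_reversible.
have weight_gt0 x : 0 < expR (- U x / T t) * pi x by rewrite mulr_gt0 ?expR_gt0.
have Z_gt0 : 0 < Z.
  (* The masses of pi sum to 1, so X is not empty. *)
  have [x _] : exists x : X, true.
    case: (pickP X) => [x _|X0]; first by exists x.
    by case: pi_distribution => _ /esym/eqP; rewrite big_pred0 // oner_eq0.
  rewrite /Z /partition_function (bigD1 x) //= ltr_wpDr //.
  by apply: sumr_ge0 => y _; exact: ltW.
have piT_gt0 x : 0 < piT x by rewrite divr_gt0.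
have rev1 : reversible M1t piT.
  exact: (gibbs_reversible U Q_reversible (@maxC _ R) (gibbs_min_rate Tt_gt0)).
have rev2 : reversible M2t piT.
  exact: (gibbs_reversible U Q_reversible (@minC _ R) (gibbs_max_rate Tt_gt0)).
have peskun : peskun_ge M2t M1t.
  move=> x y xy; rewrite /M1t /M2t /M1 /M2 /generator_of_rates (negPf xy).
  apply: ler_wpM2l; first by case: Q_generator => + _; apply.
  by rewrite ge_min le_max lexx.
have form_le f :
    inner piT (apply_gen (- M1t) f) f <= inner piT (apply_gen (- M2t) f) f.
  apply: peskun_dirichlet_le => // x; [exact: ltW| |];
    exact: sum_generator_of_rates.
split=> //; last first.
  have rev_opp G : reversible G piT -> reversible (- G) piT.
    by move=> revG x y; rewrite !mulrN revG.
  by apply: (@lambda2_le _ _ _ _ piT) => //; exact: rev_opp.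
move=> f; split; first by rewrite -lerN2 -!inner_opp_gen.
- exact: (gibbs_dirichlet_form U Q_reversible (@minC _ R)
            (gibbs_max_rate Tt_gt0)).
- exact: (gibbs_dirichlet_form U Q_reversible (@maxC _ R)
            (gibbs_min_rate Tt_gt0)).
Qed.
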